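(* Let $S$ be a star graph with a non-degenerate labeling $l_S \colon V(S) \to \mathbb{R}^{+}$. Then the following statements are equivalent: (i) The ultrametric space $(V(S), d_{l_S})$ is separable. (ii) The set $W_\varepsilon := \{v \in V(S) \colon l_S(v) \leq \varepsilon\}$ is countable for every $\varepsilon > 0$.
   Context: Graphs are simple and undirected; vertex sets may be infinite of any cardinality. A tree is a connected graph with nonempty vertex set and no cycles; any two distinct vertices of a tree are joined by exactly one (finite) path. A star graph is a tree $S$ having a vertex $c$ (the center) adjacent to every $v\in V(S)\setminus\{c\}$. $\mathbb{R}^+ = [0,\infty)$. A labeling of a tree $T$ is a map $l \colon V(T)\to\mathbb{R}^+$; it is non-degenerate if $\max\{l(u),l(v)\}>0$ for every edge $\{u,v\}\in E(T)$. Given a labeling $l$, define $d_l\colon V(T)\times V(T)\to\mathbb{R}^+$ by $d_l(u,u)=0$ and, for $u\neq v$, $d_l(u,v)=\max_{w\in V(P)} l(w)$, where $P$ is the path joining $u$ and $v$ in $T$ (endpoints included). It is known that $d_l$ is an ultrametric on $V(T)$ if and only if $l$ is non-degenerate. A set is countable if its cardinality is at most $\aleph_0$ (finite sets included). A metric space is separable if it has a countable dense subset. *)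

(* Defs.v *)
From HB Require Import structures.
From mathcomp Require Import all_boot all_order all_algebra.
From mathcomp Require Import all_classical all_reals.
From mathcomp Require Import interval_inference topology.

Set Implicit Arguments.
Unset Strict Implicit.
Unset Printing Implicit Defensive.

Import Order.TTheory GRing.Theory Num.Theory.
Local Open Scope classical_set_scope.
Local Open Scope ring_scope.

(* The vertex type is a [choiceType] of arbitrary cardinality; classically
   every type carries such a structure. *)
Record sgraph := SGraph {
  vertex :> choiceType;
  adj : rel vertex;
  adj_sym : symmetric adj;
  adj_irr : irreflexive adj }.

(* [x :: p] is the vertex sequence of a path (no repeated vertex) from x to y. *)
Definition joins (G : sgraph) (x y : G) (p : seq G) : bool :=
  [&& path (@adj G) x p, last x p == y & uniq (x :: p)].

Definition connected_graph (G : sgraph) : Prop :=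
  forall x y : G, exists p, joins x y p.

(* The size condition discards the library's degenerate simple cycles: the
   empty sequence and a single edge traversed back and forth. *)
Definition acyclic_graph (G : sgraph) : Prop :=
  forall c : seq G, (2 < size c)%N -> ~ ucycle (@adj G) c.

Record tree := Tree {
  tree_graph :> sgraph;
  tree_nonempty : inhabited tree_graph;
  tree_connected : connected_graph tree_graph;
  tree_acyclic : acyclic_graph tree_graph }.

Definition is_star (T : tree) : Prop :=
  exists c : T, forall v : T, v <> c -> adj c v.

Definition nondegenerate_labeling (R : realType) (T : tree)
    (l : T -> {nonneg R}) : Prop :=
  forall u v : T, adj u v -> 0 < Num.max (l u)%:num (l v)%:num.

(* The path joining u and v; it is unique by [joins_uniq] below. *)
Definition tree_path (T : tree) (u v : T) : seq T :=
  xchoose (@tree_connected T u v).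

(* As labels are nonnegative, the base value 0 of the iterated maximum is
   harmless. *)
Definition label_dist (R : realType) (T : tree) (l : T -> {nonneg R}) (u v : T) : R :=
  if u == v then 0
  else \big[Num.max/0]_(w <- u :: tree_path u v) (l w)%:num.

Section TreePaths.
Variable T : tree.
Implicit Types (x y z : T) (p q : seq T).

Lemma joins_uniq x y p q : joins x y p -> joins x y q -> p = q.
Proof.
elim: p x q => [|a p IH] x q.
  case: q => [|b q] // /and3P[_ /= /eqP <- _] /and3P[_ /= /eqP lq].
  by rewrite -lq mem_last.
case: q => [|b q].
  move=> /and3P[_ /= /eqP lp].
  by rewrite -lp => + /and3P[_ /= /eqP xE _]; rewrite xE mem_last.
move=> jp jq; move: (jp) (jq).
move=> /and3P[/= /andP[xa pp] lp /andP[xp up]].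
move=> /and3P[/= /andP[xb pq] lq /andP[xq uq]].
have [ab|ab] := eqVneq a b.
  subst b; congr (_ :: _); apply: (IH a); first exact/and3P.
  exact/and3P.
exfalso.
pose w := p ++ rev (belast b q).
have pw : path (@adj T) a w.
  rewrite cat_path pp /= (eqP lp) -(eqP lq) rev_path.
  by rewrite (eq_path (e' := @adj T)) // => u v; rewrite /= adj_sym.
have lw : last a w = b.
  rewrite last_cat (eqP lp); case: (q) lq => [/= /eqP <-//|c q'] /= _.
  by rewrite rev_cons last_rcons.
have xw : x \notin a :: w.
  rewrite -cat_cons mem_cat negb_or xp mem_rev.
  by apply: contra xq; exact: mem_belast.
move: lw; case: (shortenP pw) => r pr ur sr lr.
have := @tree_acyclic T (x :: a :: r); apply.
  by case: r lr {pr ur sr} => //= /eqP; rewrite (negPf ab).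
apply/andP; split.
  by rewrite /= xa rcons_path pr lr /= adj_sym.
rewrite cons_uniq ur andbT; apply: contra xw.
rewrite !inE => /orP[->//|xr]; apply/orP; right.
exact: sr.
Qed.

Lemma tree_pathP x y : joins x y (tree_path x y).
Proof. exact: (xchooseP (@tree_connected T x y)). Qed.

Lemma tree_path_sub x y p : path (@adj T) x p -> last x p = y ->
  {subset tree_path x y <= p}.
Proof.
move=> pp; case: (shortenP pp) => q pq uq sq lq w.
rewrite (@joins_uniq x y _ q (tree_pathP x y)); last by apply/and3P; rewrite lq.
exact: sq.
Qed.

End TreePaths.

Section LabelDist.
Variables (R : realType) (T : tree) (l : T -> {nonneg R}).
Local Notation d := (label_dist l).

Lemma label_dist_ge w x y : x != y -> w \in x :: tree_path x y ->
  (l w)%:num <= d x y.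
Proof.
move=> xy wp; rewrite /label_dist (negPf xy) /=.
exact: (@le_bigmax_seq _ R _ _ 0 w xpredT (fun v => (l v)%:num) wp).
Qed.

Lemma label_dist_ge0 x y : 0 <= d x y.
Proof.
rewrite /label_dist; case: eqP => // _.
by apply: (big_ind (fun z : R => 0 <= z)) => // a b a0 b0; rewrite le_max a0.
Qed.

Lemma label_dist_le x y p (m : R) : path (@adj T) x p -> last x p = y -> 0 <= m ->
  (forall w, w \in x :: p -> (l w)%:num <= m) -> d x y <= m.
Proof.
move=> pp lp m0 H; rewrite /label_dist; case: eqP => // _.
rewrite big_seq; apply: (big_ind (fun z : R => z <= m)) => //.
  by move=> a b am bm; rewrite ge_max am.
move=> w; rewrite inE => /orP[wx|wp]; apply: H; rewrite inE ?wx //.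
by rewrite (tree_path_sub pp lp) // orbT.
Qed.

Lemma label_distxx x : d x x = 0.
Proof. by rewrite /label_dist eqxx. Qed.

Lemma label_dist_strong x y z : d x z <= Num.max (d x y) (d y z).
Proof.
have [->|xy] := eqVneq x y; first by rewrite le_max lexx orbT.
have [->|yz] := eqVneq y z; first by rewrite le_max lexx.
have /and3P[p1 /eqP l1 _] := tree_pathP x y.
have /and3P[p2 /eqP l2 _] := tree_pathP y z.
apply: (@label_dist_le _ _ (tree_path x y ++ tree_path y z)).
- by rewrite cat_path p1 l1.
- by rewrite last_cat l1.
- by rewrite le_max label_dist_ge0.
- move=> w; rewrite -cat_cons mem_cat le_max => /orP[w1|w2].
    by rewrite label_dist_ge.
  by apply/orP; right; apply: label_dist_ge; rewrite // inE w2 orbT.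
Qed.

Lemma label_dist_triangle y x z : d x z <= d x y + d y z.
Proof.
apply: (le_trans (label_dist_strong x y z)).
by rewrite ge_max lerDl lerDr !label_dist_ge0.
Qed.

Lemma label_dist_sym x y : d x y = d y x.
Proof.
suff H u v : d u v <= d v u by apply/eqP; rewrite eq_le !H.
have [->//|uv] := eqVneq u v.
have /and3P[p /eqP lp _] := tree_pathP v u.
have E : last u (rev (belast v (tree_path v u))) = v.
  case: (tree_path v u) lp => [/= ->//|c q] /= _.
  by rewrite rev_cons last_rcons.
apply: (@label_dist_le _ _ _ _ _ E).
- rewrite -[X in path _ X _]lp rev_path (eq_path (e' := @adj T)) // => a b.
  by rewrite /= adj_sym.
- exact: label_dist_ge0.
- move=> w wi; apply: label_dist_ge; first by rewrite eq_sym.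
  case/predU1P: wi => [->|wr]; last by apply: mem_belast; rewrite -mem_rev.
  by rewrite -[X in X \in _]lp mem_last.
Qed.

Lemma label_dist_eq0 : nondegenerate_labeling l -> forall x y, d x y = 0 -> x = y.
Proof.
move=> nd x y d0; apply/eqP; apply: contraT => xy.
have /and3P[p /eqP lp _] := tree_pathP x y.
case E : (tree_path x y) p lp => [|a q] /=.
  by move=> _ xE; rewrite xE eqxx in xy.
move=> /andP[xa _] _; have := nd _ _ xa.
rewrite lt_max => /orP[|]; rewrite ltNge => /negP; case; rewrite -d0;
  by apply: label_dist_ge; rewrite // E !inE eqxx ?orbT.
Qed.

End LabelDist.

(* The vertex set of T, as the carrier of the metric [label_dist l]; the
   non-degeneracy proof is a parameter because it is what makes this a metric. *)
Definition label_space (R : realType) (T : tree) (l : T -> {nonneg R})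
  (nd : nondegenerate_labeling l) : Type := T.

HB.instance Definition _ (R : realType) (T : tree) (l : T -> {nonneg R})
  (nd : nondegenerate_labeling l) := Choice.on (label_space nd).

HB.instance Definition _ (R : realType) (T : tree) (l : T -> {nonneg R})
    (nd : nondegenerate_labeling l) :=
  isMetric.Build R (label_space nd) (label_distxx l) (label_dist_eq0 nd)
    (label_dist_sym l) (label_dist_triangle l).

Lemma label_space_mdistE (R : realType) (T : tree) (l : T -> {nonneg R})
    (nd : nondegenerate_labeling l) (x y : label_space nd) :
  mdist x y = label_dist l x y.
Proof. by []. Qed.

Definition separable_space (X : topologicalType) : Prop :=
  exists D : set X, countable D /\ dense D.

(* Main.v *)
Require Import Defs.
From HB Require Import structures.
From mathcomp Require Import all_boot all_order all_algebra.
From mathcomp Require Import all_classical all_reals.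
From mathcomp Require Import interval_inference topology.

Set Implicit Arguments.
Unset Strict Implicit.
Unset Printing Implicit Defensive.

Import Order.TTheory GRing.Theory Num.Theory.
Local Open Scope classical_set_scope.
Local Open Scope ring_scope.

(** Both conditions say that the star has only countably many vertices.

    For separability: the path from a leaf v to any other vertex starts with
    the edge from v to the center c, so every other vertex is at distance at
    least max(l v, l c), which is positive by non-degeneracy.  Hence every leaf
    is an isolated point ([star_leaf_isolated]) and belongs to every dense set,
    so a dense set misses at most the center; the center itself may fail to be
    isolated, when its label is 0, but one point does not affect countability
    ([separable_star_countable]).  Conversely a countable space is dense in
    itself.

    For the sublevel sets: the vertex set is their union over the integer
    levels 1, 2, ..., because every label lies below some integer
    ([countable_sublevels]). *)

(** An isolated point is an open singleton, which a dense set must meet. *)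
Lemma dense_isolated (X : topologicalType) (D : set X) (x : X) :
  dense D -> nbhs x [set x] -> D x.
Proof.
move=> dD nx; have : [set x]° !=set0 by exists x.
move=> /dD /(_ (@open_interior _ _))[y [/interior_subset/= -> //]].
Qed.

Lemma countable_sublevels (R : realType) (X : Type) (f : X -> R) :
  (forall eps : R, 0 < eps -> countable [set x | f x <= eps]) ->
  countable [set: X].
Proof.
move=> cf.
have -> : [set: X] = \bigcup_(n in [set: nat]) [set x | f x <= n.+1%:R].
  apply/esym; rewrite -subTset => x _.
  by exists (Num.truncn (f x)) => //=; rewrite ltW// truncnS_gt.
by apply: bigcup_countable => // n _; apply: cf; rewrite ltr0Sn.
Qed.

(** The walk from v to w through the center has no repeated vertex, hence is
    the tree path by uniqueness. *)
Lemma star_path_center (T : tree) (c v w : T) :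
  (forall u : T, u <> c -> adj c u) -> v <> c -> v != w ->
  c \in tree_path v w.
Proof.
move=> hc vc vw; have avc : adj v c by rewrite adj_sym; exact: hc.
have vcF : v == c = false by apply/eqP.
have [wc|wc] := eqVneq w c.
  suff -> : tree_path v w = [:: c] by rewrite inE.
  apply: joins_uniq (tree_pathP v w) _.
  by rewrite /joins /= avc wc eqxx inE vcF.
suff -> : tree_path v w = [:: c; w] by rewrite !inE eqxx.
apply: joins_uniq (tree_pathP v w) _.
rewrite /joins /= avc hc; last exact/eqP.
by rewrite eqxx !inE vcF (negPf vw) eq_sym wc.
Qed.

Lemma star_leaf_isolated (R : realType) (T : tree) (l : T -> {nonneg R})
    (nd : nondegenerate_labeling l) (c v : T) :
  (forall u : T, u <> c -> adj c u) -> v <> c ->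
  nbhs (v : label_space nd) [set v].
Proof.
move=> hc vc; apply/nbhs_ballP.
(* The radius is the larger label on the edge joining v to the center. *)
exists (Num.max (l c)%:num (l v)%:num); first exact/nd/hc.
move=> w; rewrite ballEmdist /= label_space_mdistE => dvw.
apply/eqP; rewrite eq_sym; apply: contraTT dvw => vw.
rewrite -leNgt ge_max !label_dist_ge// ?mem_head// inE.
by rewrite star_path_center ?orbT.
Qed.

Lemma separable_star_countable (R : realType) (T : tree) (hT : is_star T)
    (l : T -> {nonneg R}) (nd : nondegenerate_labeling l) :
  separable_space (label_space nd) <-> countable [set: T].
Proof.
split=> [[D [cD dD]]|cT]; last by exists setT; split=> // O O0 _; rewrite setIT.
have [c hc] := hT.
have -> : [set: T] =
    \bigcup_(b in [set: bool]) (if b then D : set T else [set c]).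
  apply/esym; rewrite -subTset => v _.
  have [->|/eqP vc] := eqVneq v c; first by exists false.
  by exists true => //; exact: dense_isolated dD (star_leaf_isolated nd hc vc).
by apply: bigcup_countable => // -[] _ //; exact: countable1.
Qed.

Theorem corollary2 (R : realType) (S : tree) (hS : is_star S)
    (lS : S -> {nonneg R}) (nd : nondegenerate_labeling lS) :
  separable_space (label_space nd) <->
  (forall eps : R, 0 < eps -> countable [set v : S | (lS v)%:num <= eps]).
Proof.
rewrite separable_star_countable//; split=> [cS eps _|].
  by apply: sub_countable cS; exact: subset_card_le.
exact: countable_sublevels.
Qed.
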